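(* For any $\rho\in\mathbb{R}$ and $\tau>2$, and for any Dirichlet polynomial $f(s)=\sum_{n=1}^\infty f_n n^{-s}$ (with complex coefficients $f_n$, only finitely many of which are non-zero), we have $$\lim_{T\to\infty}\frac{1}{2T}\int_{-T}^{T}\left|\zeta\left(\tfrac{\tau}{2}+it\right)f\left(\tfrac{\rho}{2}+it\right)\right|^2dt=\zeta(\tau)\sum_{n,m=1}^\infty f_n\overline{f_m}\,[C(\tau,\rho)]_{n,m},$$ where $\zeta$ is the Riemann zeta-function.
   Context: For real $\tau,\rho$, $C(\tau,\rho)$ is the semi-infinite matrix indexed by $n,m\in\{1,2,3,\dots\}$ with entries $$[C(\tau,\rho)]_{n,m}=\frac{(nm)^{\tau/2}}{[n,m]^{\tau}}\,\frac{1}{(nm)^{\rho/2}},$$ where $[n,m]$ in the denominator denotes the least common multiple of $n$ and $m$. *)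

(* Defs.v *)
(* Coquelicot over the Stdlib reals. *)
From Stdlib Require Import Reals Arith.
From Coquelicot Require Import Coquelicot.

Open Scope R_scope.

Definition Cexp (z : C) : C :=
  (exp (Re z) * cos (Im z), exp (Re z) * sin (Im z)).

(* [n ^ s] with the real logarithm of [n]; meaningful for [n >= 1] only. *)
Definition nat_Cpow (n : nat) (s : C) : C := Cexp (s * RtoC (ln (INR n)))%C.

(* Sum of a complex series, starting at index 0.  Like [Series], it is total
   and is the actual sum only when the series converges. *)
Definition CSeries (a : nat -> C) : C :=
  (Series (fun k => Re (a k)), Series (fun k => Im (a k))).

(* [sum_(n >= 1) a n]; the value [a 0] is ignored. *)
Definition CSeries1 (a : nat -> C) : C := CSeries (fun k => a (S k)).

(* [sum_(n >= 1) f n * n ^ (- s)] *)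
Definition dirichlet_series (f : nat -> C) (s : C) : C :=
  CSeries1 (fun n => f n * nat_Cpow n (- s))%C.

(* Finitely many non-zero coefficients. *)
Definition finitely_supported (f : nat -> C) : Prop :=
  exists N : nat, forall n : nat, (N < n)%nat -> f n = RtoC 0.

(* The Riemann zeta-function on the half-plane [Re s > 1], where it is the sum
   of its Dirichlet series; there is no analytic continuation, so the values
   outside this half-plane carry no meaning. *)
Definition riemann_zeta (s : C) : C := dirichlet_series (fun _ => RtoC 1) s.

(* Entries of the matrix, for the indices [n, m >= 1]. *)
Definition lcm_matrix (tau rho : R) (n m : nat) : R :=
  Rpower (INR n * INR m) (tau / 2) / Rpower (INR (Nat.lcm n m)) tau
  * (1 / Rpower (INR n * INR m) (rho / 2)).

(* Main.v *)
Require Import Defs.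
From Stdlib Require Import Reals Arith Lra Lia Classical.
From Coquelicot Require Import Coquelicot.

(** Write [s = tau / 2 > 1] and [r = rho / 2].  Both zeta on the line
    [Re z = s] and [f] on the line [Re z = r] are absolutely convergent
    superpositions of the oscillations [exp (- i t ln n)], so
    [|zeta f|^2 = zeta * conj zeta * conj f * f] is an absolutely convergent
    fourfold superposition of oscillations [exp (i w t)], and the mean value
    over [[-T, T]] of such an oscillation tends to 1 when [w = 0] and to 0
    otherwise.  Taking means term by term leaves the diagonal
      [sum_(n, m) f_n conj(f_m) (n m)^(-r) sum_(k, l : n k = m l) (k l)^(-s)].
    If [d] is the gcd of [n = a d] and [m = b d], the solutions of [n k = m l]
    are [k = b j], [l = a j], so the inner sum is
    [zeta(tau) (a b)^(-s)], and [(a b)^(-s) = (n m)^s / lcm(n, m)^tau].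

    Exchanging mean and sum is the only analytic step.  It rests on the fact
    that the class of continuous functions with a mean value is closed under
    uniform limits ([has_mean_uniform_approx]), hence under normally
    convergent series ([has_mean_Series]).  In the form
    [has_cmean_mult_dirichlet], it says that multiplying a bounded function
    [h] by a Dirichlet series can be averaged term by term as soon as the mean
    of [h] against every oscillation is known.  The four factors are therefore
    brought in one at a time, each time for all frequencies at once.  The
    arithmetic of the diagonal is [Series_zeta_coef]. *)

(** * Mean values of real functions *)

(** Continuity is part of the predicate because [RInt] is meaningless, and
    not additive, on functions that are not integrable; it is also what makes
    the predicate stable under uniform limits. *)
Definition has_mean (h : R -> R) (l : R) : Prop :=
  (forall t, continuous h t) /\
  is_lim (fun T => 1 / (2 * T) * RInt h (- T) T) p_infty l.

Lemma ex_RInt_of_continuous (h : R -> R) (a b : R) :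
  (forall t, continuous h t) -> ex_RInt h a b.
Proof. intros H. apply (ex_RInt_continuous h). intros z _. apply H. Qed.

Lemma has_mean_ext (h g : R -> R) (l : R) :
  (forall t, h t = g t) -> has_mean h l -> has_mean g l.
Proof.
intros E [Hc Hl]. split.
- intros t. apply continuous_ext with h; auto.
- eapply is_lim_ext; [ | exact Hl ]. intros T. simpl. f_equal. apply RInt_ext. auto.
Qed.

Lemma has_mean_plus (h g : R -> R) (l k : R) :
  has_mean h l -> has_mean g k -> has_mean (fun t => h t + g t) (l + k).
Proof.
intros [Hc Hl] [Gc Gl]. split.
- intros t. apply (continuous_plus h g t); auto.
- eapply is_lim_ext; [ | apply (is_lim_plus' _ _ _ _ _ Hl Gl) ].
  intros T. simpl.
  rewrite (RInt_plus h g); try (apply ex_RInt_of_continuous; auto).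
  change plus with Rplus. ring.
Qed.

Lemma has_mean_scal (c : R) (h : R -> R) (l : R) :
  has_mean h l -> has_mean (fun t => c * h t) (c * l).
Proof.
intros [Hc Hl]. split.
- intros t. apply (continuous_scal_r c h t); auto.
- eapply is_lim_ext; [ | apply (is_lim_scal_l _ c _ _ Hl) ].
  intros T. simpl.
  rewrite (RInt_scal h); try (apply ex_RInt_of_continuous; auto).
  change scal with Rmult. ring.
Qed.

Lemma has_mean_const (c : R) : has_mean (fun _ => c) c.
Proof.
split.
- intros t. apply continuous_const.
- eapply is_lim_ext_loc; [ | apply is_lim_const ].
  exists 0. intros T HT. rewrite RInt_const. unfold scal; simpl; unfold mult; simpl.
  field. lra.
Qed.

Lemma has_mean_unique (h : R -> R) (l k : R) :
  has_mean h l -> has_mean h k -> l = k.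
Proof.
intros [_ Hl] [_ Hk]. apply is_lim_unique in Hl. apply is_lim_unique in Hk.
rewrite Hl in Hk. now injection Hk.
Qed.

Lemma average_abs_le (h : R -> R) (B T : R) :
  (forall t, continuous h t) -> (forall t, Rabs (h t) <= B) -> 0 < T ->
  Rabs (1 / (2 * T) * RInt h (- T) T) <= B.
Proof.
intros Hc HB HT.
assert (H : Rabs (RInt h (- T) T) <= (T - - T) * B).
{ apply abs_RInt_le_const; [lra | now apply ex_RInt_of_continuous | intros; apply HB]. }
rewrite Rabs_mult, (Rabs_pos_eq (1 / (2 * T))).
- replace B with (1 / (2 * T) * ((T - - T) * B)) by (field; lra).
  apply Rmult_le_compat_l; [ | exact H].
  apply Rlt_le, Rdiv_lt_0_compat; lra.
- apply Rlt_le, Rdiv_lt_0_compat; lra.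
Qed.

(** Applied to the terms of a normally convergent series, this shows that the
    series of their means converges as well. *)
Lemma has_mean_bound (h : R -> R) (l B : R) :
  (forall t, Rabs (h t) <= B) -> has_mean h l -> Rabs l <= B.
Proof.
intros HB [Hc Hl].
assert (HT : Rbar_locally' p_infty (fun T => Rabs (1 / (2 * T) * RInt h (- T) T) <= B)).
{ exists 0. intros T HT. now apply average_abs_le. }
apply Rabs_le. split.
- apply (is_lim_le_loc _ _ p_infty (- B) l) with (2 := is_lim_const (- B) p_infty) (3 := Hl).
  revert HT. apply filter_imp. intros T H. apply Rabs_le_between in H. lra.
- apply (is_lim_le_loc _ _ p_infty l B) with (2 := Hl) (3 := is_lim_const B p_infty).
  revert HT. apply filter_imp. intros T H. apply Rabs_le_between in H. lra.
Qed.

(** The averaging operators over [[-T, T]] are contractions for the supremum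
    norm, uniformly in [T], so a uniformly small error stays small after
    averaging and the limits in [T] and in the approximation can be
    exchanged. *)
Lemma has_mean_uniform_approx (h : R -> R) (l : R) :
  (forall eps : posreal, exists g k, has_mean g k /\
     (forall t, Rabs (h t - g t) <= eps) /\ Rabs (l - k) <= eps) ->
  has_mean h l.
Proof.
intros Happ.
(* A uniform limit of continuous functions is continuous: the usual three-term
   argument, with the budget [eps/4 + eps/2 + eps/4]. *)
assert (Hc : forall t, continuous h t).
{ intros t. apply continuity_pt_filterlim. apply continuity_pt_locally. intros eps.
  destruct (Happ (pos_div_2 (pos_div_2 eps))) as (g & k & [Hg _] & Hd & _).
  assert (Gt := Hg t). apply continuity_pt_filterlim in Gt.
  rewrite continuity_pt_locally in Gt.
  generalize (Gt (pos_div_2 eps)). apply filter_imp. intros y Hy.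
  assert (H1 := Hd y). assert (H2 := Hd t). simpl in *.
  replace (h y - h t) with ((h y - g y) + (g y - g t) + - (h t - g t)) by ring.
  eapply Rle_lt_trans; [apply Rabs_triang |]. rewrite Rabs_Ropp.
  assert (H3 := Rabs_triang (h y - g y) (g y - g t)). lra. }
split; [exact Hc |].
apply is_lim_spec. intros eps.
destruct (Happ (pos_div_2 (pos_div_2 eps))) as (g & k & [Hg Lg] & Hd & Hlk).
apply is_lim_spec in Lg. destruct (Lg (pos_div_2 eps)) as [M HM].
exists (Rmax M 0). intros T HT.
assert (HT1 : M < T) by (eapply Rle_lt_trans; [apply Rmax_l | exact HT]).
assert (HT0 : 0 < T) by (eapply Rle_lt_trans; [apply Rmax_r | exact HT]).
specialize (HM T HT1). simpl in *.
assert (Hdc : forall t, continuous (fun t => h t - g t) t).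
{ intros t. apply (continuous_minus h g t); auto. }
assert (H1 := average_abs_le _ _ T Hdc Hd HT0).
rewrite (RInt_minus h g) in H1; try (apply ex_RInt_of_continuous; auto).
change minus with Rminus in H1.
set (c := 1 / (2 * T)) in *. set (x := RInt h (- T) T) in *.
set (y := RInt g (- T) T) in *.
replace (c * x - l) with (c * (x - y) + (c * y - k) + - (l - k)) by ring.
eapply Rle_lt_trans; [apply Rabs_triang |]. rewrite Rabs_Ropp.
assert (H3 := Rabs_triang (c * (x - y)) (c * y - k)). lra.
Qed.

Lemma has_mean_sum (u : nat -> R -> R) (c : nat -> R) (n : nat) :
  (forall k, has_mean (u k) (c k)) ->
  has_mean (fun t => sum_n (fun k => u k t) n) (sum_n c n).
Proof.
intros H. induction n as [| n IH].
- rewrite sum_O. apply has_mean_ext with (u O); auto. intros t. now rewrite sum_O.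
- rewrite sum_Sn. eapply has_mean_ext; [ | apply has_mean_plus; [apply IH | apply (H (S n))]].
  intros t. simpl. now rewrite sum_Sn.
Qed.

Lemma ex_series_abs_le (a b : nat -> R) :
  (forall k, Rabs (a k) <= b k) -> ex_series b -> ex_series a.
Proof. intros H Hb. now apply (ex_series_le a b). Qed.

Lemma Series_tail_le (a b : nat -> R) (n : nat) :
  (forall k, Rabs (a k) <= b k) -> ex_series b ->
  Rabs (Series a - sum_n a n) <= Series b - sum_n b n.
Proof.
intros H Hb.
assert (Ha : ex_series a) by now apply ex_series_abs_le with b.
rewrite (Series_incr_n a (S n)), (Series_incr_n b (S n)); auto; try lia. simpl.
rewrite !sum_n_Reals.
replace (_ - _) with (Series (fun k => a (S (n + k)))) by ring.
replace (_ - _) with (Series (fun k => b (S (n + k)))) by ring.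
assert (Hb' : ex_series (fun k => b (S (n + k)))) by now apply (ex_series_incr_n b (S n)).
eapply Rle_trans; [apply Series_Rabs |].
- apply ex_series_abs_le with (2 := Hb'). intros k. now rewrite Rabs_Rabsolu.
- apply Series_le; auto. intros k. split; [apply Rabs_pos | apply H].
Qed.

(** The tail of [b] controls uniformly the tails of the functions and, by
    [has_mean_bound], those of their means. *)
Lemma has_mean_Series (u : nat -> R -> R) (c b : nat -> R) :
  (forall k t, Rabs (u k t) <= b k) -> ex_series b ->
  (forall k, has_mean (u k) (c k)) ->
  has_mean (fun t => Series (fun k => u k t)) (Series c).
Proof.
intros Hb Eb Hm. apply has_mean_uniform_approx. intros eps.
assert (Sb := Series_correct _ Eb).
assert (Lb : is_lim_seq (sum_n b) (Series b)) by exact Sb.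
apply is_lim_seq_spec in Lb. destruct (Lb eps) as [N HN].
specialize (HN N (le_n N)).
assert (Ht : Series b - sum_n b N <= eps).
{ apply Rlt_le. apply Rabs_lt_between in HN. lra. }
exists (fun t => sum_n (fun k => u k t) N), (sum_n c N). split; [| split].
- now apply has_mean_sum.
- intros t. eapply Rle_trans; [ | exact Ht]. apply Series_tail_le; auto.
- eapply Rle_trans; [ | exact Ht]. apply Series_tail_le; auto.
  intros k. apply has_mean_bound with (u k); auto.
Qed.

(** * Mean values of complex functions *)

Definition has_cmean (h : R -> C) (l : C) : Prop :=
  has_mean (fun t => Re (h t)) (Re l) /\ has_mean (fun t => Im (h t)) (Im l).

Lemma has_cmean_ext (h g : R -> C) (l : C) :
  (forall t, h t = g t) -> has_cmean h l -> has_cmean g l.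
Proof.
intros E [H1 H2]. split.
- apply has_mean_ext with (2 := H1). intros t. now rewrite E.
- apply has_mean_ext with (2 := H2). intros t. now rewrite E.
Qed.

Lemma has_cmean_scal (c : C) (h : R -> C) (l : C) :
  has_cmean h l -> has_cmean (fun t => c * h t)%C (c * l)%C.
Proof.
intros [H1 H2]. destruct c as [a b], l as [x y]. split; simpl in *.
- replace (a * x - b * y) with (a * x + - b * y) by ring.
  eapply has_mean_ext; [| apply has_mean_plus; apply has_mean_scal; eassumption].
  intros t. unfold Re, Im. simpl. ring.
- eapply has_mean_ext; [| apply has_mean_plus; apply has_mean_scal; eassumption].
  intros t. unfold Re, Im. simpl. ring.
Qed.

Lemma has_cmean_conj (h : R -> C) (l : C) :
  has_cmean h l -> has_cmean (fun t => Cconj (h t)) (Cconj l).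
Proof.
intros [H1 H2]. split; [exact H1 |].
rewrite im_conj. replace (- Im l) with (-1 * Im l) by ring.
eapply has_mean_ext; [| apply has_mean_scal, H2].
intros t. rewrite im_conj. ring.
Qed.

Lemma im_le_Cmod (z : C) : Rabs (Im z) <= Cmod z.
Proof. eapply Rle_trans; [apply Rmax_r | apply Rmax_Cmod]. Qed.

Lemma has_cmean_CSeries (u : nat -> R -> C) (c : nat -> C) (b : nat -> R) :
  (forall k t, Cmod (u k t) <= b k) -> ex_series b ->
  (forall k, has_cmean (u k) (c k)) ->
  has_cmean (fun t => CSeries (fun k => u k t)) (CSeries c).
Proof.
intros Hb Eb Hm. split; simpl.
- apply (has_mean_Series (fun k t => Re (u k t)) _ b); auto.
  + intros k t. eapply Rle_trans; [apply re_le_Cmod | apply Hb].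
  + intros k. apply Hm.
- apply (has_mean_Series (fun k t => Im (u k t)) _ b); auto.
  + intros k t. eapply Rle_trans; [apply im_le_Cmod | apply Hb].
  + intros k. apply Hm.
Qed.

(** * Oscillations *)

(** The function [exp (i w t)]. *)
Definition osc (w t : R) : C := (cos (w * t), sin (w * t)).

Definition delta0 (w : R) : R := if Req_EM_T w 0 then 1 else 0.

Lemma osc_plus (w v t : R) : osc (w + v) t = (osc w t * osc v t)%C.
Proof.
unfold osc, Cmult. simpl. rewrite Rmult_plus_distr_r, cos_plus, sin_plus.
f_equal; ring.
Qed.

Lemma osc_conj (w t : R) : Cconj (osc w t) = osc (- w) t.
Proof.
unfold osc, Cconj. simpl. rewrite Ropp_mult_distr_l_reverse, cos_neg, sin_neg.
reflexivity.
Qed.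

Lemma Cmod_osc (w t : R) : Cmod (osc w t) = 1.
Proof.
unfold Cmod, osc. simpl.
replace (_ + _) with ((sin (w * t))² + (cos (w * t))²) by (unfold Rsqr; ring).
rewrite sin2_cos2. apply sqrt_1.
Qed.

Lemma continuous_cos_scal (w t : R) : continuous (fun t => cos (w * t)) t.
Proof. apply (ex_derive_continuous (fun t => cos (w * t))). auto_derive; auto. Qed.

Lemma continuous_sin_scal (w t : R) : continuous (fun t => sin (w * t)) t.
Proof. apply (ex_derive_continuous (fun t => sin (w * t))). auto_derive; auto. Qed.

(** The integral over [[-T, T]] stays bounded by [2 / |w|], while it is
    divided by [2 T]. *)
Lemma has_mean_cos (w : R) : w <> 0 -> has_mean (fun t => cos (w * t)) 0.
Proof.
intros Hw. split; [apply continuous_cos_scal |].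
assert (HI : forall T, RInt (fun t => cos (w * t)) (- T) T = 2 * sin (w * T) / w).
{ intros T. apply is_RInt_unique.
  replace (2 * sin (w * T) / w) with
    (minus (sin (w * T) / w) (sin (w * - T) / w)).
  - apply (is_RInt_derive (fun t => sin (w * t) / w)).
    + intros t _. auto_derive; auto. field. auto.
    + intros t _. apply continuous_cos_scal.
  - rewrite Ropp_mult_distr_r_reverse, sin_neg.
    unfold minus, plus, opp; simpl. field. auto. }
apply is_lim_spec. intros eps.
assert (Hw' := Rabs_pos_lt w Hw). assert (He := cond_pos eps).
exists (/ (Rabs w * eps)). intros T HT.
assert (HT0 : 0 < T).
{ eapply Rlt_trans; [| exact HT]. apply Rinv_0_lt_compat. now apply Rmult_lt_0_compat. }
rewrite HI, Rminus_0_r.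
replace (1 / (2 * T) * (2 * sin (w * T) / w)) with (sin (w * T) * / (w * T)) by (field; lra).
rewrite Rabs_mult, Rabs_inv, Rabs_mult, (Rabs_pos_eq T); [| lra].
apply Rle_lt_trans with (1 * / (Rabs w * T)).
- apply Rmult_le_compat_r.
  + apply Rlt_le, Rinv_0_lt_compat. now apply Rmult_lt_0_compat.
  + apply Rabs_le. apply SIN_bound.
- rewrite Rmult_1_l.
  replace (pos eps) with (/ (Rabs w * / (Rabs w * eps))) by (field; lra).
  apply Rinv_lt_contravar.
  + repeat apply Rmult_lt_0_compat; try lra.
    apply Rinv_0_lt_compat. now apply Rmult_lt_0_compat.
  + now apply Rmult_lt_compat_l.
Qed.

(** Oddness: the integral over [[-T, T]] vanishes for every [T]. *)
Lemma has_mean_sin (w : R) : w <> 0 -> has_mean (fun t => sin (w * t)) 0.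
Proof.
intros Hw. split; [apply continuous_sin_scal |].
apply is_lim_ext with (fun _ => 0); [| apply is_lim_const].
intros T. symmetry. apply Rmult_eq_0_compat_l. apply is_RInt_unique.
replace 0 with (minus (- cos (w * T) / w) (- cos (w * - T) / w)).
- apply (is_RInt_derive (fun t => - cos (w * t) / w)).
  + intros t _. auto_derive; auto. field. auto.
  + intros t _. apply continuous_sin_scal.
- rewrite Ropp_mult_distr_r_reverse, cos_neg. unfold minus, plus, opp; simpl. ring.
Qed.

(** The orthogonality that makes only the diagonal terms survive. *)
Lemma has_cmean_osc (w : R) : has_cmean (osc w) (RtoC (delta0 w)).
Proof.
unfold delta0. destruct (Req_EM_T w 0) as [-> | Hw]; split; simpl.
- apply has_mean_ext with (2 := has_mean_const 1). intros t.
  rewrite Rmult_0_l. symmetry. apply cos_0.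
- apply has_mean_ext with (2 := has_mean_const 0). intros t.
  rewrite Rmult_0_l. symmetry. apply sin_0.
- now apply has_mean_cos.
- now apply has_mean_sin.
Qed.

(** * Complex series *)

Lemma Series_zero : Series (fun _ => 0) = 0.
Proof.
rewrite (Series_ext _ (fun _ => 0 * 0)) by (intros k; ring).
rewrite Series_scal_l. ring.
Qed.

Definition Csummable1 (a : nat -> C) : Prop := ex_series (fun k => Cmod (a (S k))).

Lemma Csummable1_parts (a : nat -> C) : Csummable1 a ->
  ex_series (fun k => Re (a (S k))) /\ ex_series (fun k => Im (a (S k))).
Proof.
intros H. split; apply ex_series_abs_le with (2 := H); intros k.
- apply re_le_Cmod.
- apply im_le_Cmod.
Qed.

Lemma CSeries1_ext (a b : nat -> C) :
  (forall n, (0 < n)%nat -> a n = b n) -> CSeries1 a = CSeries1 b.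
Proof.
intros H. unfold CSeries1, CSeries.
f_equal; apply Series_ext; intros k; rewrite H; auto; lia.
Qed.

Lemma CSeries1_scal (c : C) (a : nat -> C) : Csummable1 a ->
  CSeries1 (fun n => c * a n)%C = (c * CSeries1 a)%C.
Proof.
intros H. destruct (Csummable1_parts a H) as [H1 H2]. destruct c as [x y].
unfold CSeries1, CSeries, Cmult. simpl. f_equal.
- rewrite <- !Series_scal_l, <- Series_minus; [reflexivity | |];
  now apply (ex_series_scal_l (V := R_NormedModule)).
- rewrite <- !Series_scal_l, <- Series_plus; [reflexivity | |];
  now apply (ex_series_scal_l (V := R_NormedModule)).
Qed.

Lemma CSeries1_conj (a : nat -> C) :
  CSeries1 (fun n => Cconj (a n)) = Cconj (CSeries1 a).
Proof.
unfold CSeries1, CSeries, Cconj. simpl. f_equal. now rewrite Series_opp.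
Qed.

Lemma CSeries1_RtoC (a : nat -> R) :
  CSeries1 (fun n => RtoC (a n)) = RtoC (Series (fun k => a (S k))).
Proof.
unfold CSeries1, CSeries, RtoC. simpl. f_equal. exact Series_zero.
Qed.

Lemma Cmod_CSeries1_le (a : nat -> C) (b : nat -> R) :
  (forall k, Cmod (a (S k)) <= b k) -> ex_series b ->
  Cmod (CSeries1 a) <= sqrt 2 * Series b.
Proof.
intros H Hb. eapply Rle_trans; [apply Cmod_2Rmax |].
apply Rmult_le_compat_l; [apply sqrt_pos |].
assert (P : forall c : nat -> R, (forall k, Rabs (c k) <= b k) -> Rabs (Series c) <= Series b).
{ intros c Hc. eapply Rle_trans; [apply Series_Rabs |].
  - apply ex_series_abs_le with (2 := Hb). intros k. now rewrite Rabs_Rabsolu.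
  - apply Series_le; auto. intros k. split; [apply Rabs_pos | apply Hc]. }
apply Rmax_lub; apply P; intros k; eapply Rle_trans; try apply H.
- apply re_le_Cmod.
- apply im_le_Cmod.
Qed.

(** * Mean values of products with Dirichlet series *)

(** On a vertical line, each term of a Dirichlet series is an oscillation of
    constant amplitude; absolute convergence at one point of the line is thus
    normal convergence on the whole line. *)
Lemma nat_Cpow_vertical (n : nat) (x t : R) :
  nat_Cpow n (- (RtoC x + Ci * RtoC t))%C =
  (RtoC (Rpower (INR n) (- x)) * osc (- ln (INR n)) t)%C.
Proof.
unfold nat_Cpow, Cexp, osc, Rpower, RtoC, Cmult, Ci. simpl.
replace (- (x + (0 * t - 1 * 0)) * ln (INR n) - - (0 + (0 * 0 + 1 * t)) * 0)
  with (- x * ln (INR n)) by ring.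
replace (- (x + (0 * t - 1 * 0)) * 0 + - (0 + (0 * 0 + 1 * t)) * ln (INR n))
  with (- ln (INR n) * t) by ring.
f_equal; ring.
Qed.

Definition cbounded (h : R -> C) : Prop := exists B, forall t, Cmod (h t) <= B.

Lemma cbounded_mult (h g : R -> C) :
  cbounded h -> cbounded g -> cbounded (fun t => h t * g t)%C.
Proof.
intros [A HA] [B HB]. exists (A * B). intros t. rewrite Cmod_mult.
apply Rmult_le_compat; auto using Cmod_ge_0.
Qed.

Lemma cbounded_conj (h : R -> C) : cbounded h -> cbounded (fun t => Cconj (h t)).
Proof. intros [A HA]. exists A. intros t. now rewrite Cmod_conj. Qed.

Lemma cbounded_osc (w : R) : cbounded (osc w).
Proof. exists 1. intros t. rewrite Cmod_osc. lra. Qed.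

Definition converges_absolutely (a : nat -> C) (x : R) : Prop :=
  Csummable1 (fun n => a n * RtoC (Rpower (INR n) (- x)))%C.

Lemma Cmod_dirichlet_term (a : C) (n : nat) (x t : R) :
  Cmod (a * nat_Cpow n (- (RtoC x + Ci * RtoC t))) =
  Cmod (a * RtoC (Rpower (INR n) (- x))).
Proof. rewrite nat_Cpow_vertical, !Cmod_mult, Cmod_osc. ring. Qed.

Lemma dirichlet_series_bounded (a : nat -> C) (x : R) :
  converges_absolutely a x ->
  cbounded (fun t => dirichlet_series a (RtoC x + Ci * RtoC t)%C).
Proof.
intros H. eexists. intros t. unfold dirichlet_series.
apply Cmod_CSeries1_le with (2 := H). intros k. simpl.
rewrite Cmod_dirichlet_term. apply Rle_refl.
Qed.

(** Only the means of [h] against the frequencies [- ln n] enter.  Since the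
    product is again bounded, and [h] may itself carry an arbitrary
    oscillation, the lemma can be iterated over several Dirichlet series. *)
Lemma has_cmean_mult_dirichlet (h : R -> C) (a c : nat -> C) (x : R) :
  cbounded h -> converges_absolutely a x ->
  (forall n, (0 < n)%nat ->
     has_cmean (fun t => h t * osc (- ln (INR n)) t)%C (c n)) ->
  has_cmean (fun t => h t * dirichlet_series a (RtoC x + Ci * RtoC t))%C
    (CSeries1 (fun n => a n * RtoC (Rpower (INR n) (- x)) * c n))%C.
Proof.
intros [B HB] Ha Hm.
apply has_cmean_ext with (fun t => CSeries1 (fun n =>
  h t * (a n * nat_Cpow n (- (RtoC x + Ci * RtoC t))))%C).
{ intros t. apply CSeries1_scal. unfold Csummable1.
  eapply ex_series_ext; [| exact Ha]. intros k. simpl.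
  symmetry. apply Cmod_dirichlet_term. }
apply (has_cmean_CSeries
  (fun k t => h t * (a (S k) * nat_Cpow (S k) (- (RtoC x + Ci * RtoC t))))%C
  _ (fun k => B * Cmod (a (S k) * RtoC (Rpower (INR (S k)) (- x))))).
- intros k t. rewrite Cmod_mult, Cmod_dirichlet_term.
  apply Rmult_le_compat_r; [apply Cmod_ge_0 | apply HB].
- now apply (ex_series_scal_l (V := R_NormedModule)).
- intros k. eapply has_cmean_ext; [| apply has_cmean_scal, (Hm (S k)); lia].
  intros t. rewrite nat_Cpow_vertical. ring.
Qed.

(** Obtained by conjugating [has_cmean_mult_dirichlet] for [conj h], which
    reverses the sign of the frequencies. *)
Lemma has_cmean_mult_conj_dirichlet (h : R -> C) (a c : nat -> C) (x : R) :
  cbounded h -> converges_absolutely a x ->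
  (forall n, (0 < n)%nat ->
     has_cmean (fun t => h t * osc (ln (INR n)) t)%C (c n)) ->
  has_cmean (fun t => h t * Cconj (dirichlet_series a (RtoC x + Ci * RtoC t)))%C
    (CSeries1 (fun n => Cconj (a n) * RtoC (Rpower (INR n) (- x)) * c n))%C.
Proof.
intros Hb Ha Hm.
assert (H := has_cmean_mult_dirichlet _ a (fun n => Cconj (c n)) x
  (cbounded_conj _ Hb) Ha).
assert (H' := has_cmean_conj _ _ (H ltac:(
  intros n Hn; eapply has_cmean_ext; [| apply has_cmean_conj, (Hm n Hn)];
  intros t; simpl; now rewrite Cmult_conj, osc_conj))).
rewrite <- CSeries1_conj in H'.
erewrite CSeries1_ext; [eapply has_cmean_ext; [| exact H'] |].
- intros t. simpl. now rewrite Cmult_conj, Cconj_conj.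
- intros n _. simpl. rewrite !Cmult_conj, Cconj_conj. f_equal. f_equal.
  unfold Cconj, RtoC; simpl. f_equal. ring.
Qed.

(** * Sparse series and the convergence of the zeta series *)

Lemma Series_single (F : nat -> R) (p : nat) :
  (forall k, k <> p -> F k = 0) -> Series F = F p.
Proof.
intros H. apply is_series_unique.
assert (E : forall n, (n < p)%nat -> sum_n F n = 0).
{ induction n as [| n IH]; intros Hn.
  - rewrite sum_O. apply H. lia.
  - rewrite sum_Sn, IH, H by lia. apply Rplus_0_r. }
assert (E' : forall i, sum_n F (p + i) = F p).
{ induction i as [| i IH].
  - rewrite Nat.add_0_r. destruct p as [| p]; [apply sum_O |].
    rewrite sum_Sn, E by lia. apply Rplus_0_l.
  - rewrite Nat.add_succ_r, sum_Sn, IH, (H (S (p + i))) by lia. apply Rplus_0_r. }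
change (is_lim_seq (sum_n F) (F p)).
apply (is_lim_seq_incr_n _ p).
apply is_lim_seq_ext with (fun _ => F p); [| apply is_lim_seq_const].
intros n. now rewrite Nat.add_comm, E'.
Qed.

(** Between two multiples of [q] the partial sums are constant, so the partial
    sums of the right-hand series form a subsequence of those of the left-hand
    one. *)
Lemma Series_multiples (g : nat -> R) (q : nat) :
  (0 < q)%nat -> ex_series (fun k => g (S k)) ->
  (forall l, (0 < l)%nat -> ~ Nat.divide q l -> g l = 0) ->
  Series (fun k => g (S k)) = Series (fun j => g (q * S j)%nat).
Proof.
intros Hq Hex H0. destruct q as [| p]; [lia |]. clear Hq.
set (F := fun k => g (S k)) in *.
(* The shift of indices by one puts the multiple [q * S K] of [q = S p] at the
   index [p + S p * K]; the [p] indices before it carry zeros. *)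
assert (HF : forall K i, (i < p)%nat -> F (S p * K + i)%nat = 0).
{ intros K i Hi. apply H0; [lia |]. intros [z Hz].
  assert (z <= K \/ S K <= z)%nat as [Hl | Hl] by lia; nia. }
assert (HF0 : forall i, (i < p)%nat -> F i = 0).
{ intros i Hi. rewrite <- (HF O i Hi). f_equal. lia. }
assert (E : forall K, sum_n F (p + S p * K) = sum_n (fun j => g (S p * S j)%nat) K).
{ induction K as [| K IH].
  - rewrite sum_O, Nat.mul_0_r, Nat.add_0_r.
    assert (Z : forall i, (i < p)%nat -> sum_n F i = 0).
    { induction i as [| i IHi]; intros Hi.
      - rewrite sum_O. now apply HF0.
      - rewrite sum_Sn, IHi, HF0 by lia. apply Rplus_0_r. }
    destruct p as [| p'].
    + rewrite sum_O. unfold F. f_equal.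
    + rewrite sum_Sn, Z by lia. unfold plus; simpl. rewrite Rplus_0_l. unfold F.
      f_equal. lia.
  - assert (Z : forall i, (i <= p)%nat ->
      sum_n F (p + S p * K + i) = sum_n F (p + S p * K)).
    { induction i as [| i IHi]; intros Hi; [now rewrite Nat.add_0_r |].
      rewrite Nat.add_succ_r, sum_Sn, IHi by lia.
      replace (F (S (p + S p * K + i))) with 0; [apply Rplus_0_r |].
      rewrite <- (HF (S K) i) by lia. f_equal. lia. }
    replace (p + S p * S K)%nat with (S (p + S p * K + p)) by lia.
    rewrite sum_Sn, Z, IH, sum_Sn by lia. f_equal. unfold F. f_equal. lia. }
symmetry. apply is_series_unique.
change (is_lim_seq (sum_n (fun j => g (S p * S j)%nat)) (Series F)).
apply is_lim_seq_ext with (fun K => sum_n F (p + S p * K)); [exact E |].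
apply (is_lim_seq_subseq (sum_n F) _ (fun K => p + S p * K)%nat).
- apply eventually_subseq. intros n. lia.
- exact (Series_correct F Hex).
Qed.

Lemma INR_S_pos (k : nat) : 0 < INR (S k).
Proof. apply lt_0_INR. lia. Qed.

Lemma Rpower_le_1 (x s : R) : 1 <= x -> 0 <= s -> Rpower x (- s) <= 1.
Proof.
intros Hx Hs. rewrite Rpower_Ropp, <- Rinv_1.
apply Rinv_le_contravar; [lra |].
rewrite <- (Rpower_O x) by lra. apply Rle_Rpower; lra.
Qed.

Lemma Rpower_pos (x y : R) : 0 < Rpower x y.
Proof. apply exp_pos. Qed.

(** The integral comparison for [y^(-s)], without integrals.  With [y = x + 1], the ratio [x^(1-s) / y^(1-s)] is
    [exp ((s-1) (ln y - ln x))], which is at least [1 + (s-1) / y] because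
    [ln y - ln x >= 1 / y]. *)
Lemma Rpower_telescope (k : nat) (s : R) : 1 < s ->
  (s - 1) * Rpower (INR (S (S k))) (- s) <=
  Rpower (INR (S k)) (1 - s) - Rpower (INR (S (S k))) (1 - s).
Proof.
intros Hs. assert (Hk := INR_S_pos k). assert (Hk' := INR_S_pos (S k)).
set (x := INR (S k)) in *. set (y := INR (S (S k))) in *.
assert (Hxy : y = x + 1) by (unfold x, y; now rewrite (S_INR (S k))).
assert (Hln : / y <= ln y - ln x).
{ assert (H := exp_ineq1_le (ln x - ln y)).
  unfold Rminus in H. rewrite exp_plus, exp_Ropp, !exp_ln in H by auto.
  replace (x * / y) with (1 - / y) in H; [lra |].
  rewrite Hxy. field. lra. }
replace (Rpower x (1 - s)) with (Rpower y (1 - s) * exp ((s - 1) * (ln y - ln x))).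
- replace (Rpower y (- s)) with (Rpower y (1 - s) * / y).
  + assert (H := exp_ineq1_le ((s - 1) * (ln y - ln x))).
    assert (H2 : (s - 1) * / y <= (s - 1) * (ln y - ln x)) by (apply Rmult_le_compat_l; lra).
    assert (P := Rpower_pos y (1 - s)).
    set (w := Rpower y (1 - s)) in *. set (E := exp _) in *.
    assert (w * ((s - 1) * / y) <= w * (E - 1)) by (apply Rmult_le_compat_l; lra).
    lra.
  + rewrite <- (Rpower_1 y) at 2 by auto. rewrite <- Rpower_Ropp, <- Rpower_plus.
    f_equal. ring.
- unfold Rpower. rewrite <- exp_plus. f_equal. ring.
Qed.

(** Domination by a telescoping series. *)
Lemma ex_series_Rpower (s : R) : 1 < s ->
  ex_series (fun k => Rpower (INR (S k)) (- s)).
Proof.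
intros Hs. apply (ex_series_incr_1 (V := R_NormedModule)).
apply ex_series_abs_le with
  (fun k => / (s - 1) * (Rpower (INR (S k)) (1 - s) - Rpower (INR (S (S k))) (1 - s))).
{ intros k. rewrite Rabs_pos_eq by (apply Rlt_le, Rpower_pos).
  apply Rmult_le_reg_l with (s - 1); [lra |].
  rewrite <- Rmult_assoc, Rinv_r, Rmult_1_l by lra. now apply Rpower_telescope. }
apply (ex_series_scal_l (V := R_NormedModule)).
set (d := fun k => _ - _).
assert (Hd : forall n, sum_n d n = 1 - Rpower (INR (S (S n))) (1 - s)).
{ induction n as [| n IH].
  - rewrite sum_O. unfold d. f_equal. change (INR 1) with 1.
    unfold Rpower. rewrite ln_1, Rmult_0_r. apply exp_0.
  - rewrite sum_Sn, IH. unfold d, plus; simpl plus. simpl. ring. }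
destruct (ex_finite_lim_seq_incr (sum_n d) 1) as [l Hl].
- intros n. rewrite sum_Sn. unfold plus; simpl.
  assert (H := Rpower_telescope (S n) s Hs).
  assert (P := Rpower_pos (INR (S (S (S n)))) (- s)).
  assert (0 <= (s - 1) * Rpower (INR (S (S (S n)))) (- s)) by (apply Rmult_le_pos; lra).
  unfold d. lra.
- intros n. rewrite Hd. assert (P := Rpower_pos (INR (S (S n))) (1 - s)). lra.
- now exists l.
Qed.

(** * The diagonal sum *)

(** The mean value of [exp (i w t) zeta(s + i t)]: the coefficient of zeta at
    the frequency [- w]. *)
Definition zeta_coef (s w : R) : R :=
  Series (fun k => Rpower (INR (S k)) (- s) * delta0 (w + - ln (INR (S k)))).

Lemma zeta_coef_ln (s : R) (p : nat) : (0 < p)%nat ->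
  zeta_coef s (ln (INR p)) = Rpower (INR p) (- s).
Proof.
intros Hp. destruct p as [| p]; [lia |]. unfold zeta_coef.
rewrite (Series_single _ p); unfold delta0.
- destruct (Req_EM_T _ 0) as [_ | H]; [ring | exfalso; apply H; ring].
- intros k Hk. destruct (Req_EM_T _ 0) as [H | _]; [exfalso | ring].
  apply Hk. assert (E : INR (S p) = INR (S k)) by (apply ln_inv; try apply INR_S_pos; lra).
  apply INR_eq in E. lia.
Qed.

Lemma zeta_coef_eq_0 (s w : R) :
  (forall p, (0 < p)%nat -> w <> ln (INR p)) -> zeta_coef s w = 0.
Proof.
intros H. transitivity (Series (fun _ => 0)); [| exact Series_zero].
apply Series_ext. intros k. unfold delta0.
destruct (Req_EM_T _ 0) as [E | _]; [exfalso | ring].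
apply (H (S k)); [lia | lra].
Qed.

Lemma zeta_coef_bound (s w : R) : 0 <= s -> Rabs (zeta_coef s w) <= 1.
Proof.
intros Hs. destruct (classic (exists p, (0 < p)%nat /\ w = ln (INR p))) as [[p [Hp ->]] | H].
- rewrite zeta_coef_ln, Rabs_pos_eq by (auto; apply Rlt_le, Rpower_pos).
  apply Rpower_le_1; auto. now apply (le_INR 1).
- rewrite zeta_coef_eq_0, Rabs_R0; [lra |]. intros p Hp E. apply H. now exists p.
Qed.

(** For [n = a d] and [m = b d] with [d] their gcd, [n m = a b d^2] and
    [lcm(n, m) = a b d], so that the powers of [d] cancel in
    [(n m)^(tau/2) / lcm(n, m)^tau]. *)
Lemma lcm_matrix_coprime_parts (tau rho : R) (a b d : nat) :
  (0 < a)%nat -> (0 < b)%nat -> (0 < d)%nat -> Nat.gcd (a * d) (b * d) = d ->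
  lcm_matrix tau rho (a * d) (b * d) =
  Rpower (INR (a * b)) (- (tau / 2)) *
  (Rpower (INR (a * d)) (- (rho / 2)) * Rpower (INR (b * d)) (- (rho / 2))).
Proof.
intros Ha Hb Hd Hg. unfold lcm_matrix, Nat.lcm. rewrite Hg, Nat.div_mul by lia.
assert (Pa := lt_0_INR a Ha). assert (Pb := lt_0_INR b Hb). assert (Pd := lt_0_INR d Hd).
rewrite !Rpower_Ropp, !mult_INR.
set (x := INR a) in *. set (y := INR b) in *. set (z := INR d) in *.
assert (Pxy : 0 < x * y) by now apply Rmult_lt_0_compat.
replace (x * z * (y * z)) with ((x * y) * (z * z)) by ring.
replace (x * z * y) with ((x * y) * z) by ring.
replace tau with (tau / 2 + tau / 2) at 2 by field.
rewrite <- !Rpower_mult_distr, !Rpower_plus by (repeat apply Rmult_lt_0_compat; auto).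
assert (P := fun u => Rpower_pos u (tau / 2)). assert (Q := fun u => Rpower_pos u (rho / 2)).
assert (A1 := P x). assert (A2 := P y). assert (A3 := P z).
assert (B1 := Q x). assert (B2 := Q y). assert (B3 := Q z).
field. repeat split; lra.
Qed.

(** The sum over the solutions of [n k = m l].  With [n = a d], [m = b d] and
    [a], [b] coprime, the frequency [ln m - ln n + ln l] is the logarithm of an
    integer [k] exactly when [a] divides [l], and for [l = a j] that integer is
    [k = b j]. *)
Lemma Series_zeta_coef (tau rho : R) (n m : nat) : 2 < tau ->
  (0 < n)%nat -> (0 < m)%nat ->
  Series (fun k => Rpower (INR (S k)) (- (tau / 2)) *
    zeta_coef (tau / 2) (- ln (INR n) + ln (INR m) + ln (INR (S k)))) *
    (Rpower (INR n) (- (rho / 2)) * Rpower (INR m) (- (rho / 2))) =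
  Series (fun k => Rpower (INR (S k)) (- tau)) * lcm_matrix tau rho n m.
Proof.
intros Ht Hn Hm. set (s := tau / 2). assert (Hs : 1 < s) by (unfold s; lra).
set (d := Nat.gcd n m).
destruct (Nat.gcd_divide_l n m) as [a Ea]. destruct (Nat.gcd_divide_r n m) as [b Eb].
fold d in Ea, Eb.
assert (Hd : (0 < d)%nat) by (destruct d; lia).
assert (Ha : (0 < a)%nat) by (destruct a; lia).
assert (Hb : (0 < b)%nat) by (destruct b; lia).
assert (Hab : Nat.gcd a b = 1%nat).
{ assert (G : (Nat.gcd a b * d)%nat = d).
  { rewrite <- Nat.gcd_mul_mono_r, <- Ea, <- Eb. reflexivity. }
  nia. }
assert (Hg : Nat.gcd (a * d) (b * d) = d) by (rewrite <- Ea, <- Eb; reflexivity).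
clearbody d. subst n m.
rewrite lcm_matrix_coprime_parts by auto. fold s.
rewrite <- !Rmult_assoc. f_equal. f_equal.
assert (Pa := lt_0_INR a Ha). assert (Pb := lt_0_INR b Hb). assert (Pd := lt_0_INR d Hd).
rewrite !mult_INR, !ln_mult by auto.
set (w := - _ + _).
assert (Hw : w = ln (INR b) - ln (INR a)) by (unfold w; ring). clearbody w. subst w.
set (g := fun l => Rpower (INR l) (- s) * zeta_coef s (ln (INR b) - ln (INR a) + ln (INR l))).
change (Series (fun k => g (S k)) =
  Series (fun k => Rpower (INR (S k)) (- tau)) * Rpower (INR a * INR b) (- s)).
rewrite (Series_multiples g a Ha).
(* The diagonal terms, [l = a * S j] and [k = b * S j]. *)
- rewrite <- Series_scal_r. apply Series_ext. intros j. unfold g.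
  assert (Pj := INR_S_pos j).
  replace (_ + ln (INR (a * S j))) with (ln (INR (b * S j))).
  + rewrite zeta_coef_ln by lia. rewrite !mult_INR, <- !Rpower_mult_distr by auto.
    replace (- tau) with (- s + - s) by (unfold s; field). rewrite Rpower_plus. ring.
  + rewrite !mult_INR, !ln_mult by auto. ring.
- apply ex_series_abs_le with (2 := ex_series_Rpower s Hs). intros k. unfold g.
  assert (P := Rpower_pos (INR (S k)) (- s)).
  rewrite Rabs_mult, (Rabs_pos_eq (Rpower _ _)) by lra.
  rewrite <- (Rmult_1_r (Rpower _ _)) at 2. apply Rmult_le_compat_l; [lra |].
  apply zeta_coef_bound. lra.
(* Off the diagonal: [b * l = a * p] forces [a] to divide [l]. *)
- intros l Hl Hdiv. unfold g. rewrite zeta_coef_eq_0; [ring |].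
  intros p Hp E. apply Hdiv.
  assert (Pl := lt_0_INR l Hl). assert (Pp := lt_0_INR p Hp).
  assert (E' : ln (INR (b * l)) = ln (INR (a * p))) by (rewrite !mult_INR, !ln_mult by auto; lra).
  apply ln_inv in E'; try (apply lt_0_INR; nia). apply INR_eq in E'.
  apply (Nat.gauss a b l); auto. exists p. lia.
Qed.

(** * The mean square *)

Lemma finitely_supported_Csummable1 (a : nat -> C) :
  finitely_supported a -> Csummable1 a.
Proof.
intros [N HN]. unfold Csummable1.
apply (ex_series_incr_n (V := R_NormedModule) _ (S N)).
apply ex_series_abs_le with (fun _ => 0).
- intros k. rewrite HN by lia. rewrite Cmod_0, Rabs_R0. lra.
- exists 0. change (is_lim_seq (sum_n (fun _ => 0)) 0).
  apply is_lim_seq_ext with (fun _ => 0); [| apply is_lim_seq_const].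
  intros n. rewrite sum_n_const. ring.
Qed.

Lemma finitely_supported_factor (f a : nat -> C) :
  finitely_supported f -> (forall n, f n = RtoC 0 -> a n = RtoC 0) ->
  finitely_supported a.
Proof. intros [N HN] H. exists N. intros n Hn. apply H, HN, Hn. Qed.

Lemma ones_converge_absolutely (s : R) : 1 < s ->
  converges_absolutely (fun _ => RtoC 1) s.
Proof.
intros Hs. unfold converges_absolutely, Csummable1.
apply ex_series_ext with (2 := ex_series_Rpower s Hs). intros k. simpl.
rewrite Cmod_mult, !Cmod_R, Rabs_R1, Rabs_pos_eq; [simpl; ring | apply Rlt_le, Rpower_pos].
Qed.

Lemma riemann_zeta_real (tau : R) :
  riemann_zeta (RtoC tau) = RtoC (Series (fun k => Rpower (INR (S k)) (- tau))).
Proof.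
unfold riemann_zeta, dirichlet_series.
rewrite <- (CSeries1_RtoC (fun n => Rpower (INR n) (- tau))). apply CSeries1_ext. intros n _.
replace (RtoC tau) with (RtoC tau + Ci * RtoC 0)%C by ring.
rewrite nat_Cpow_vertical. unfold osc. rewrite Rmult_0_r, cos_0, sin_0.
change (1, 0) with (RtoC 1). ring.
Qed.

(** The factors zeta, conj zeta, conj f and f are introduced in this order.
    Each intermediate mean is computed against all the oscillations [osc w],
    since the next factor evaluates it at the shifted frequencies
    [w + ln n] or [w - ln n]. *)
Lemma has_cmean_zeta_square_dirichlet (rho tau : R) (f : nat -> C) :
  2 < tau -> finitely_supported f ->
  let F t := (riemann_zeta (RtoC (tau / 2) + Ci * RtoC t) *
              dirichlet_series f (RtoC (rho / 2) + Ci * RtoC t))%C in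
  has_cmean (fun t => F t * Cconj (F t))%C
    (riemann_zeta (RtoC tau) *
        CSeries1 (fun n => CSeries1 (fun m =>
          f n * Cconj (f m) * RtoC (lcm_matrix tau rho n m))))%C.
Proof.
intros Ht Hf F. set (s := tau / 2). set (r := rho / 2).
assert (Hs : 1 < s) by (unfold s; lra).
assert (Cz := ones_converge_absolutely s Hs).
assert (Cf : converges_absolutely f r).
{ apply finitely_supported_Csummable1. apply finitely_supported_factor with (1 := Hf).
  intros n ->. ring. }
set (z := fun t => riemann_zeta (RtoC s + Ci * RtoC t)%C).
set (p := fun t => dirichlet_series f (RtoC r + Ci * RtoC t)%C).
assert (Bz : cbounded z) by exact (dirichlet_series_bounded _ _ Cz).
assert (Bp : cbounded p) by exact (dirichlet_series_bounded _ _ Cf).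
assert (M1 : forall w, has_cmean (fun t => osc w t * z t)%C (RtoC (zeta_coef s w))).
{ intros w. unfold zeta_coef.
  rewrite <- (CSeries1_RtoC (fun n => Rpower (INR n) (- s) * delta0 (w + - ln (INR n)))).
  erewrite CSeries1_ext; [apply has_cmean_mult_dirichlet; [apply cbounded_osc | exact Cz |] |].
  - intros n Hn. eapply has_cmean_ext; [| apply (has_cmean_osc (w + - ln (INR n)))].
    intros t. apply osc_plus.
  - intros n _. simpl. rewrite RtoC_mult. ring. }
set (S2 := fun w => Series (fun k => Rpower (INR (S k)) (- s) * zeta_coef s (w + ln (INR (S k))))).
assert (M2 : forall w, has_cmean (fun t => osc w t * z t * Cconj (z t))%C (RtoC (S2 w))).
{ intros w. unfold S2.
  rewrite <- (CSeries1_RtoC (fun n => Rpower (INR n) (- s) * zeta_coef s (w + ln (INR n)))).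
  erewrite CSeries1_ext; [apply has_cmean_mult_conj_dirichlet;
    [apply cbounded_mult; [apply cbounded_osc | exact Bz] | exact Cz |] |].
  - intros n Hn. eapply has_cmean_ext; [| apply (M1 (w + ln (INR n)))].
    intros t. simpl. rewrite osc_plus. ring.
  - intros n _. simpl. rewrite RtoC_mult.
    replace (Cconj (RtoC 1)) with (RtoC 1) by (unfold Cconj, RtoC; simpl; f_equal; ring). ring. }
set (S3 := fun w => CSeries1 (fun m =>
  Cconj (f m) * RtoC (Rpower (INR m) (- r)) * RtoC (S2 (w + ln (INR m))%R))%C).
assert (M3 : forall w, has_cmean (fun t => osc w t * z t * Cconj (z t) * Cconj (p t))%C (S3 w)).
{ intros w. apply has_cmean_mult_conj_dirichlet; [| exact Cf |].
  - apply cbounded_mult; [apply cbounded_mult; [apply cbounded_osc | exact Bz] |].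
    now apply cbounded_conj.
  - intros n Hn. eapply has_cmean_ext; [| apply (M2 (w + ln (INR n)))].
    intros t. simpl. rewrite osc_plus. ring. }
assert (M4 : has_cmean (fun t => F t * Cconj (F t))%C
  (CSeries1 (fun n => f n * RtoC (Rpower (INR n) (- r)) * S3 (- ln (INR n))%R))%C).
{ eapply has_cmean_ext; [| apply has_cmean_mult_dirichlet with
    (h := (fun t => z t * Cconj (z t) * Cconj (p t))%C); [| exact Cf |]].
  - intros t. unfold F. rewrite Cmult_conj. fold s r. fold (z t). fold (p t). ring.
  - apply cbounded_mult; [apply cbounded_mult; [exact Bz |] |]; now apply cbounded_conj.
  - intros n Hn. eapply has_cmean_ext; [| apply M3].
    intros t. simpl. ring. }
(* All the series in [f] are finite, so that the constant [zeta(tau)] moves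
   inside them. *)
rewrite <- CSeries1_scal.
2: { apply finitely_supported_Csummable1. apply finitely_supported_factor with (1 := Hf).
  intros n ->. rewrite (CSeries1_ext _ (fun _ => RtoC 0)) by (intros; ring).
  rewrite (CSeries1_RtoC (fun _ => 0)), Series_zero. reflexivity. }
erewrite CSeries1_ext; [exact M4 |]. intros n Hn. simpl. unfold S3.
rewrite <- !CSeries1_scal.
2, 3: apply finitely_supported_Csummable1; apply finitely_supported_factor with (1 := Hf);
  intros m ->; unfold Cconj, RtoC, Cmult; simpl; f_equal; ring.
apply CSeries1_ext. intros m Hm. simpl.
assert (E := Series_zeta_coef tau rho n m Ht Hn Hm). fold s r in E.
fold (S2 (- ln (INR n) + ln (INR m))) in E.
rewrite riemann_zeta_real.
transitivity (f n * Cconj (f m) * RtoC (Series (fun k => Rpower (INR (S k)) (- tau)) * lcm_matrix tau rho n m)%R)%C.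
- rewrite RtoC_mult. ring.
- rewrite <- E, !RtoC_mult. ring.
Qed.

Theorem proposition4p1 (rho tau : R) (htau : 2 < tau)
    (f : nat -> C) (hf : finitely_supported f) :
  filterlim
    (fun T : R =>
       RtoC (1 / (2 * T) *
             RInt (fun t : R =>
                     Cmod (riemann_zeta (RtoC (tau / 2) + Ci * RtoC t) *
                           dirichlet_series f (RtoC (rho / 2) + Ci * RtoC t))%C
                     ^ 2)
                  (- T) T))
    (Rbar_locally p_infty)
    (locally
       (riemann_zeta (RtoC tau) *
        CSeries1 (fun n => CSeries1 (fun m =>
          f n * Cconj (f m) * RtoC (lcm_matrix tau rho n m))))%C).
Proof.
destruct (has_cmean_zeta_square_dirichlet rho tau f htau hf) as [HRe HIm].
set (L := Cmult _ _) in *.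
assert (E : forall w : C, Re (w * Cconj w) = Cmod w ^ 2 /\ Im (w * Cconj w) = 0).
{ intros w. rewrite <- Cmod2_conj. split; reflexivity. }
(* The limit is real because it is the mean value of a real function. *)
assert (HL : L = RtoC (Re L)).
{ unfold RtoC. rewrite (surjective_pairing L) at 1. unfold Re. f_equal.
  apply (has_mean_unique (fun _ => 0)); [| apply has_mean_const].
  apply has_mean_ext with (2 := HIm). intros t. apply E. }
rewrite HL.
apply filterlim_comp with (g := RtoC) (G := locally (Re L)).
- apply (has_mean_ext _ (fun t => Cmod (riemann_zeta (RtoC (tau / 2) + Ci * RtoC t) *
    dirichlet_series f (RtoC (rho / 2) + Ci * RtoC t))%C ^ 2)) in HRe.
  + apply HRe.
  + intros t. apply E.
- apply filterlim_locally. intros eps. exists eps. intros y Hy.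
  split; [exact Hy | apply ball_center].
Qed.
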